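(* Let $D$ be a principal ideal domain and let $M=\bigoplus_{i\in I}M_i$ be a non-zero direct sum of finitely generated torsion-free $D$-modules $M_i$. Then $D$ is a morphic ring if and only if $M$ is a weakly-morphic $D$-module.
   Context: All modules are unital. A $D$-module $M$ is torsion-free if $ma=0$ implies $a=0$ or $m=0$ for all $m\in M$, $a\in D$. A $D$-module $M$ is weakly-morphic if $M/Ma\cong \mathrm{Ann}_M(a)$ as $D$-modules for every $a\in D$, where $\mathrm{Ann}_M(a)=\{m\in M: ma=0\}$. A commutative ring $D$ is morphic if $D/aD\cong \mathrm{Ann}_D(a)$ as $D$-modules for every $a\in D$, where $\mathrm{Ann}_D(a)=\{r\in D: ar=0\}$. *)

(* Defs.v *)
From HB Require Import structures.
From mathcomp Require Import all_boot all_algebra.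
From mathcomp Require Import boolp classical_sets functions cardinality.

Set Implicit Arguments.
Unset Strict Implicit.
Unset Printing Implicit Defensive.

Import GRing.Theory.
Local Open Scope ring_scope.
Local Open Scope quotient_scope.

Section Submodule.
Variables (R : pzRingType) (V : lmodType R) (U : submodClosed V).

Record submodule := Submodule { submodule_val :> V; _ : submodule_val \in U }.

HB.instance Definition _ := [isSub for submodule_val].
HB.instance Definition _ := [Choice of submodule by <:].
HB.instance Definition _ := [SubChoice_isSubLmodule of submodule by <:].

End Submodule.

Section QuotientModule.
Variables (R : pzRingType) (V : lmodType R) (U : submodClosed V).

(* submodClosed is stated over semimodules and does not inherit from zmodClosed. *)
Definition submod_pred : {pred V} := fun v => v \in U.

Fact submod_pred_zmod_closed : zmod_closed submod_pred.
Proof. exact: (GRing.subsemimod_closedB (GRing.subsemimodClosedP U)). Qed.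

HB.instance Definition _ :=
  GRing.isZmodClosed.Build V submod_pred submod_pred_zmod_closed.

Definition quotmod := Quotient.quot submod_pred.

HB.instance Definition _ :=
  EqQuotient.copy quotmod (Quotient.quot submod_pred).
HB.instance Definition _ := GRing.Zmodule.on quotmod.
HB.instance Definition _ :=
  @isZmodQuotient.Build V (Quotient.equiv submod_pred) 0 -%R +%R quotmod
    (lock _) (@Quotient.pi_opp V submod_pred)
    (@Quotient.pi_add V submod_pred).

Definition quotmod_scale (r : R) (x : quotmod) : quotmod :=
  \pi_quotmod (r *: repr x).

Lemma quotmod_eq (x y : V) :
  (\pi_quotmod x == \pi_quotmod y) = (x - y \in U).
Proof. by rewrite piE. Qed.

Lemma pi_quotmod_scale (r : R) (x : V) :
  \pi_quotmod (r *: x) = quotmod_scale r (\pi_quotmod x).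
Proof.
apply/eqP; rewrite quotmod_eq -scalerBr rpredZ// -quotmod_eq.
by rewrite reprK.
Qed.

Fact quotmod_scaleA (a b : R) (x : quotmod) :
  quotmod_scale a (quotmod_scale b x) = quotmod_scale (a * b) x.
Proof. by elim/quotW: x => v; rewrite -(pi_quotmod_scale b) -!pi_quotmod_scale scalerA. Qed.

Fact quotmod_scale1 : left_id 1 quotmod_scale.
Proof. by elim/quotW => v; rewrite -pi_quotmod_scale scale1r. Qed.

Fact quotmod_scaleDr : right_distributive quotmod_scale +%R.
Proof.
move=> a; elim/quotW => u; elim/quotW => v.
by rewrite -raddfD -!pi_quotmod_scale scalerDr raddfD.
Qed.

Fact quotmod_scaleDl (x : quotmod) :
  {morph quotmod_scale^~ x : a b / a + b}.
Proof.
by elim/quotW: x => v a b; rewrite -!pi_quotmod_scale scalerDl raddfD.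
Qed.

HB.instance Definition _ := GRing.Zmodule_isLmodule.Build R quotmod
  quotmod_scaleA quotmod_scale1 quotmod_scaleDr quotmod_scaleDl.

End QuotientModule.

Definition lmod_iso (R : pzRingType) (V W : lmodType R) : Prop :=
  exists f : {linear V -> W}, bijective f.

Section WeaklyMorphic.
Variables (R : comPzRingType) (V : lmodType R) (a : R).

(* The submodule Va; modules over a commutative ring are written on the left. *)
Definition mulsub : {pred V} := fun v => `[< exists w : V, v = a *: w >].

Fact mulsub_submod_closed : submod_closed mulsub.
Proof.
split; first by apply/asboolP; exists 0; rewrite scaler0.
move=> r u v /asboolP[u' ->] /asboolP[v' ->]; apply/asboolP.
by exists (r *: u' + v'); rewrite scalerDr !scalerA mulrC.
Qed.
HB.instance Definition _ :=
  GRing.isSubmodClosed.Build R V mulsub mulsub_submod_closed.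

Definition annsub : {pred V} := fun v => a *: v == 0.

Fact annsub_submod_closed : submod_closed annsub.
Proof.
split; first by rewrite unfold_in scaler0.
move=> r u v; rewrite !unfold_in => /eqP au /eqP av.
by rewrite scalerDr scalerA mulrC -scalerA au av scaler0 addr0.
Qed.
HB.instance Definition _ :=
  GRing.isSubmodClosed.Build R V annsub annsub_submod_closed.

End WeaklyMorphic.

Arguments mulsub {R} V a.
Arguments annsub {R} V a.

Definition weakly_morphic (R : comPzRingType) (V : lmodType R) : Prop :=
  forall a : R, lmod_iso (quotmod (mulsub V a)) (submodule (annsub V a)).

(* In R^o the action a *: x is the product a * x, so that mulsub R^o a is the
   ideal aR and annsub R^o a is Ann_R(a). *)
Definition morphic_ring (R : comPzRingType) : Prop :=
  forall a : R, lmod_iso (quotmod (mulsub R^o a)) (submodule (annsub R^o a)).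

Definition torsion_free (R : comPzRingType) (V : lmodType R) : Prop :=
  forall (v : V) (a : R), a *: v = 0 -> a = 0 \/ v = 0.

Definition finitely_generated (R : pzRingType) (V : lmodType R) : Prop :=
  exists (n : nat) (g : 'I_n -> V),
    forall v : V, exists c : 'I_n -> R, v = \sum_(i < n) c i *: g i.

Definition ideal (R : comPzRingType) (J : set R) : Prop :=
  [/\ J 0, forall x y, J x -> J y -> J (x + y)
    & forall r x, J x -> J (r * x)].

Definition principal_ideal_domain (D : idomainType) : Prop :=
  forall J : set D, ideal J ->
    exists d : D, forall x : D, J x <-> exists r : D, x = r * d.

Section DirectSum.
Variables (R : pzRingType) (I : Type) (V : I -> lmodType R).
Local Open Scope classical_set_scope.

Record dirsum := DirSum {
  dirsum_val :> forall i : I, V i;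
  dirsum_finsupp : finite_set [set i | dirsum_val i != 0]
}.

HB.instance Definition _ := gen_eqMixin dirsum.
HB.instance Definition _ := gen_choiceMixin dirsum.

Lemma dirsumP (f g : dirsum) : (forall i, f i = g i) -> f = g.
Proof.
case: f g => [f pf] [g pg] /= fg.
have efg : f = g by apply: functional_extensionality_dep.
by case: _ / efg in pg *; congr DirSum; apply: Prop_irrelevance.
Qed.

Fact dirsum0_subproof : finite_set [set i | (0 : V i) != 0].
Proof.
apply: (sub_finite_set _ (@finite_set0 I)) => i /=.
by rewrite eqxx.
Qed.
Definition dirsum0 := DirSum dirsum0_subproof.

Fact dirsumN_subproof (f : dirsum) : finite_set [set i | - f i != 0].
Proof.
by apply: (sub_finite_set _ (dirsum_finsupp f)) => i /=; rewrite oppr_eq0.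
Qed.
Definition dirsumN (f : dirsum) := DirSum (dirsumN_subproof f).

Fact dirsumD_subproof (f g : dirsum) : finite_set [set i | f i + g i != 0].
Proof.
have fin : finite_set ([set i | f i != 0] `|` [set i | g i != 0]).
  by rewrite finite_setU; split; apply: dirsum_finsupp.
apply: (sub_finite_set _ fin) => i /=.
have [->|fi _] := eqVneq (f i) 0; last by left.
by rewrite add0r; right.
Qed.
Definition dirsumD (f g : dirsum) := DirSum (dirsumD_subproof f g).

Fact dirsumZ_subproof (r : R) (f : dirsum) : finite_set [set i | r *: f i != 0].
Proof.
apply: (sub_finite_set _ (dirsum_finsupp f)) => i /=.
by apply: contra_neq => ->; rewrite scaler0.
Qed.
Definition dirsumZ (r : R) (f : dirsum) := DirSum (dirsumZ_subproof r f).

Fact dirsumDA : associative dirsumD.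
Proof. by move=> f g h; apply: dirsumP => i /=; rewrite addrA. Qed.
Fact dirsumDC : commutative dirsumD.
Proof. by move=> f g; apply: dirsumP => i /=; rewrite addrC. Qed.
Fact dirsum0D : left_id dirsum0 dirsumD.
Proof. by move=> f; apply: dirsumP => i /=; rewrite add0r. Qed.
Fact dirsumND : left_inverse dirsum0 dirsumN dirsumD.
Proof. by move=> f; apply: dirsumP => i /=; rewrite addNr. Qed.

HB.instance Definition _ :=
  GRing.isZmodule.Build dirsum dirsumDA dirsumDC dirsum0D dirsumND.

Fact dirsumZA (a b : R) (f : dirsum) :
  dirsumZ a (dirsumZ b f) = dirsumZ (a * b) f.
Proof. by apply: dirsumP => i /=; rewrite scalerA. Qed.
Fact dirsum1Z : left_id 1 dirsumZ.
Proof. by move=> f; apply: dirsumP => i /=; rewrite scale1r. Qed.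
Fact dirsumZDr : right_distributive dirsumZ +%R.
Proof. by move=> a f g; apply: dirsumP => i /=; rewrite scalerDr. Qed.
Fact dirsumZDl (f : dirsum) : {morph dirsumZ^~ f : a b / a + b}.
Proof. by move=> a b; apply: dirsumP => i /=; rewrite scalerDl. Qed.

HB.instance Definition _ := GRing.Zmodule_isLmodule.Build R dirsum
  dirsumZA dirsum1Z dirsumZDr dirsumZDl.

End DirectSum.

(* Main.v *)
Require Import Defs.
From HB Require Import structures.
From mathcomp Require Import all_boot all_algebra.
From mathcomp Require Import boolp classical_sets functions cardinality.

(** Over a domain [D], the annihilator in a torsion-free module [V] of a nonzero
    scalar [a] vanishes, so that [V / aV] is isomorphic to it exactly when
    [V = aV]; for [a = 0] both modules are [V].  Hence a torsion-free module is
    weakly-morphic if and only if it is divisible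
    ([torsion_free_weakly_morphicP]).

    This applies to [D] itself, which is a torsion-free module over itself and is
    divisible exactly when it is a field, and to the direct sum [M].  Over a
    field every module is divisible.  Conversely, if [M] is divisible then so is
    each summand, and one of them is nonzero; a nonzero finitely generated
    torsion-free module [N] with [N = aN] forces [a] to be invertible
    ([fg_torsion_free_mul_surj_unit]).  The last point is Nakayama's determinant
    trick: writing generators [g] as [g = a C g], the determinant of [1 - a C]
    annihilates [N], hence is zero, while it is congruent to [1] modulo [a]. *)

Set Implicit Arguments.
Unset Strict Implicit.
Unset Printing Implicit Defensive.

Import GRing.Theory.
Local Open Scope ring_scope.
Local Open Scope quotient_scope.

Definition divisible (R : pzRingType) (V : lmodType R) : Prop :=
  forall a : R, a != 0 -> forall v : V, exists w : V, v = a *: w.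

Lemma lmod_iso_zero (R : pzRingType) (V W : lmodType R) :
  (forall v : V, v = 0) -> (forall w : W, w = 0) -> lmod_iso V W.
Proof.
move=> V0 W0; exists (\0 : {linear V -> W}).
by exists (fun=> 0) => x; rewrite ?V0 // [RHS]W0.
Qed.

(** Since [mulsub V 0] is the zero submodule, the choice of a representative in
    [V / 0V] is already linear, and it is the inverse of the projection. *)
Lemma weakly_morphic_at0 (R : comPzRingType) (V : lmodType R) :
  lmod_iso (quotmod (mulsub V 0)) (submodule (annsub V 0)).
Proof.
have pi_inj (x y : V) : \pi_(quotmod (mulsub V 0)) x = \pi y -> x = y.
  move=> /eqP; rewrite quotmod_eq => /asboolP[w]; rewrite scale0r.
  by move/eqP; rewrite subr_eq0 => /eqP.
have ann0 (v : V) : v \in annsub V 0 by rewrite unfold_in scale0r.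
pose f (x : quotmod (mulsub V 0)) := Submodule (ann0 (repr x)).
have f_linear : linear f.
  move=> r x y; apply: val_inj => /=; apply: pi_inj; rewrite reprK.
  by rewrite raddfD /= pi_quotmod_scale !reprK.
pose fL := GRing.isLinear.Build _ _ _ _ f f_linear.
pose F : {linear _ -> _} := HB.pack f fL.
pose g (v : submodule (annsub V 0)) := \pi_(quotmod (mulsub V 0)) (val v).
exists F; exists g => [x|v]; rewrite /g /=.
  by rewrite reprK.
by apply: val_inj; apply: pi_inj; rewrite /= reprK.
Qed.

(** For [a] nonzero the annihilator is trivial, so an isomorphism with [V / aV]
    only says that [V / aV] is trivial too. *)
Lemma torsion_free_weakly_morphicP (R : comPzRingType) (V : lmodType R) :
  torsion_free V -> weakly_morphic V <-> divisible V.
Proof.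
move=> tfV.
have ann_eq0 a : a != 0 -> forall x : submodule (annsub V a), x = 0.
  move=> a_neq0 x; apply: val_inj => /=.
  have /eqP ax0 : a *: val x == 0 := valP x.
  by case: (tfV _ _ ax0) => // a0; rewrite a0 eqxx in a_neq0.
split=> [wm a a_neq0 v | divV a].
  have [f /bij_inj f_inj] := wm a.
  have /eqP : \pi_(quotmod (mulsub V a)) v = \pi 0.
    by apply: f_inj; rewrite [LHS]ann_eq0 // [RHS]ann_eq0.
  by rewrite quotmod_eq subr0 => /asboolP.
have [->|a_neq0] := eqVneq a 0; first exact: weakly_morphic_at0.
apply: lmod_iso_zero; last exact: ann_eq0.
elim/quotW=> v; rewrite -(raddf0 (\pi_(quotmod (mulsub V a)))).
by apply/eqP; rewrite quotmod_eq subr0; apply/asboolP; apply: divV.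
Qed.

(** Multiplying the relations by the adjugate of [A] turns their matrix into
    the scalar matrix of [\det A]. *)
Lemma det_annihilates (R : comNzRingType) (V : lmodType R) n
    (A : 'M[R]_n) (g : 'I_n -> V) :
  (forall i, \sum_j A i j *: g j = 0) -> forall k, \det A *: g k = 0.
Proof.
move=> Ag0 k.
transitivity (\sum_j (\adj A *m A) k j *: g j).
  rewrite mul_adj_mx (bigD1 k) //= mxE eqxx mulr1n big1 ?addr0 // => j jk.
  by rewrite mxE eq_sym (negPf jk) scale0r.
under eq_bigr => j _ do rewrite mxE scaler_suml.
rewrite exchange_big big1 //= => i _.
under eq_bigr => j _ do rewrite -scalerA.
by rewrite -scaler_sumr Ag0 scaler0.
Qed.

(** [\det (1 - a C)] is the value at [a] of the polynomial [\det (1 - X C)],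
    whose constant term is 1. *)
Lemma det_1sub_scale (R : comNzRingType) n (C : 'M[R]_n) (a : R) :
  exists b : R, \det (1%:M - a *: C) = 1 - b * a.
Proof.
pose p : {poly R} := \det (1%:M - 'X *: map_mx polyC C).
have pE x : p.[x] = \det (1%:M - x *: C).
  rewrite -[LHS]/(horner_eval x p) -det_map_mx; congr (\det _).
  apply/matrixP=> i j; rewrite !mxE /= /horner_eval.
  by rewrite hornerD hornerN hornerMn hornerM hornerX !hornerC.
have : root (1 - p) 0.
  by apply/rootP; rewrite hornerD hornerN hornerC pE scale0r subr0 det1 subrr.
case/factor_theorem=> q; rewrite subr0 => pq; exists q.[a].
have -> : q.[a] * a = (1 - p).[a] by rewrite pq hornerMX.
by rewrite hornerD hornerN hornerC pE opprB [RHS]addrC subrK.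
Qed.

(** With [g = a C g] for generators [g], the scalar [\det (1 - a C)] kills [v],
    so it is zero; being of the form [1 - b a], it exhibits an inverse of [a]. *)
Lemma fg_torsion_free_mul_surj_unit (R : comUnitRingType) (V : lmodType R)
    (a : R) (v : V) :
  finitely_generated V -> torsion_free V -> v <> 0 ->
  (forall x : V, exists y : V, x = a *: y) -> a \is a GRing.unit.
Proof.
move=> [n [g g_gen]] tfV v_neq0 a_surj.
have [C gC] : exists C : 'M[R]_n, forall i, g i = a *: \sum_j C i j *: g j.
  have /choice[c gc] (i : 'I_n) :
      exists c : 'I_n -> R, g i = a *: \sum_j c j *: g j.
    by have [y ->] := a_surj (g i); have [c ->] := g_gen y; exists c.
  exists (\matrix_(i, j) c i j) => i; rewrite {1}gc.
  by congr (_ *: _); apply: eq_bigr => j _; rewrite mxE.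
have det_v0 : \det (1%:M - a *: C) *: v = 0.
  have [c ->] := g_gen v; rewrite scaler_sumr big1 // => k _.
  rewrite scalerA mulrC -scalerA det_annihilates ?scaler0 // => i.
  under eq_bigr => j _ do rewrite !mxE scalerBl -scalerA.
  rewrite sumrB -scaler_sumr -gC (bigD1 i) //= eqxx scale1r big1 ?addr0 ?subrr //.
  by move=> j ji; rewrite eq_sym (negPf ji) scale0r.
have [b detE] := det_1sub_scale C a.
have [/eqP det0|//] := tfV _ _ det_v0.
rewrite detE subr_eq0 eq_sym in det0.
by apply/unitrPr; exists b; rewrite mulrC (eqP det0).
Qed.

Lemma units_divisible (R : unitRingType) (V : lmodType R) :
  (forall a : R, a != 0 -> a \is a GRing.unit) -> divisible V.
Proof.
move=> unitR a /unitR aU v.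
by exists (a^-1 *: v); rewrite scalerA divrr // scale1r.
Qed.

Lemma regular_divisibleP (R : comUnitRingType) :
  divisible (R^o : lmodType R) <-> forall a : R, a != 0 -> a \is a GRing.unit.
Proof.
split=> [divR a a_neq0 | unitR]; last exact: units_divisible.
by have [b ab1] := divR a a_neq0 1; apply/unitrPr; exists b.
Qed.

Section DirectSumSummands.
Variables (R : comPzRingType) (I : Type) (M_ : I -> lmodType R).

Lemma dirsum_torsion_free :
  (forall i, torsion_free (M_ i)) -> torsion_free (dirsum M_).
Proof.
move=> tfM v a av0; have [->|a_neq0] := eqVneq a 0; [by left | right].
apply: dirsumP => i; have avi0 : a *: v i = 0 := congr1 (fun f : dirsum M_ => f i) av0.
by case: (tfM i _ _ avi0) => // a0; rewrite a0 eqxx in a_neq0.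
Qed.

Lemma dirsum_neq0 (m : dirsum M_) : m <> 0 -> exists i, m i <> 0.
Proof.
move=> m_neq0; apply: contrapT => /forallNP m0; apply: m_neq0.
by apply: dirsumP => i; apply: contrapT; apply: m0.
Qed.

(** The witness is the family supported at the single index [i]. *)
Lemma dirsum_coord_surj i (x : M_ i) : exists m : dirsum M_, m i = x.
Proof.
(* [I] is a bare type, so equality of indices is decided classically. *)
pose m := @dfwith {classic I} M_ (fun=> 0) i x.
have m_fin : finite_set [set j | m j != 0]%classic.
  apply: (sub_finite_set _ (finite_set1 i)) => j /=.
  have [//|ji] := eqVneq (j : {classic I}) i.
  by rewrite /m dfwith_out ?eqxx // eq_sym.
by exists (DirSum m_fin); rewrite /= /m dfwith_in.
Qed.

Lemma dirsum_divisible_coord i : divisible (dirsum M_) -> divisible (M_ i).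
Proof.
move=> divM a a_neq0 x; have [m <-] := dirsum_coord_surj x.
by have [w ->] := divM a a_neq0 m; exists (w i).
Qed.

End DirectSumSummands.

Theorem proposition10 (D : idomainType) (D_pid : principal_ideal_domain D)
    (I : Type) (M_ : I -> lmodType D)
    (M_fg : forall i : I, finitely_generated (M_ i))
    (M_tf : forall i : I, torsion_free (M_ i))
    (M_neq0 : exists m : dirsum M_, m <> 0) :
  morphic_ring D <-> weakly_morphic (dirsum M_).
Proof.
have tfD : torsion_free (D^o : lmodType D).
  move=> v a /eqP; rewrite [_ *: _]/(a * v) mulf_eq0.
  by case/orP=> /eqP ->; [left | right].
rewrite -[morphic_ring D]/(weakly_morphic (D^o : lmodType D)).
rewrite (torsion_free_weakly_morphicP tfD) regular_divisibleP.
rewrite (torsion_free_weakly_morphicP (dirsum_torsion_free M_tf)).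
split=> [unitD | divM a a_neq0]; first exact: units_divisible.
have [m /dirsum_neq0[i mi_neq0]] := M_neq0.
apply: (fg_torsion_free_mul_surj_unit (M_fg i) (M_tf i) mi_neq0).
exact: dirsum_divisible_coord.
Qed.
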